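(* Let $\langle A,N\rangle$ be a complete and saturated N4-structure and let $\|\cdot\|$ be any fixed interpretation mapping of the sentences of $\mathcal{L}_{\langle A,N\rangle}$ in $A$ (as in the context). Then all set-theoretic axioms of $ZF_{N4}$ (Extensionality, Pairing, Collection, Powerset, Separation, Empty set, Union, Infinity, Regularity) are valid in $\mathbf{V}^{\langle A,N\rangle}$.
   Context: A complete and saturated N4-structure is a pair $\langle A,N\rangle$ with $A$ a complete Heyting algebra (least element $0$, greatest element $1$) and $N=\{N_x\}_{x\in A}$ with $N_x=A$ for all $x\in A$. Fix a model $\mathbf{V}$ of set theory. By transfinite recursion, $\mathbf{V}_\xi=\{x: x\text{ is a function},\ \mathrm{ran}(x)\subseteq A,\ \mathrm{dom}(x)\subseteq\mathbf{V}_\zeta\text{ for some }\zeta<\xi\}$, and $\mathbf{V}^{\langle A,N\rangle}$ is the class of all $x$ belonging to some $\mathbf{V}_\xi$. $\mathcal{L}_{\langle A,N\rangle}$ is the first-order language with connectives $\to,\wedge,\vee,\neg,\bot$, quantifiers, binary predicates $\in,\approx$, and a constant for each element of $\mathbf{V}^{\langle A,N\rangle}$; $\alpha\leftrightarrow\beta$ is $(\alpha\to\beta)\wedge(\beta\to\alpha)$, $\exists x\in u\,\varphi$ is $\exists x(x\in u\wedge\varphi)$, $\forall x\in u\,\varphi$ is $\forall x(x\in u\to\varphi)$. An interpretation mapping is a mapping $\|\cdot\|$ from the sentences to $A$ such that: $\|\bot\|=0$; $\|u\in v\|=\bigvee_{x\in\mathrm{dom}(v)}(v(x)\wedge\|x\approx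 u\|)$; $\|u\approx v\|=\bigwedge_{x\in\mathrm{dom}(u)}(u(x)\to\|x\in v\|)\wedge\bigwedge_{x\in\mathrm{dom}(v)}(v(x)\to\|x\in u\|)$; $\|\varphi\#\psi\|=\|\varphi\|\#\|\psi\|$ for $\#\in\{\wedge,\vee,\to\}$; $\|\neg\varphi\|\in N_{\|\varphi\|}$ and $\|\neg\neg\varphi\|=\|\varphi\|$; $\|u\approx v\|\le\|\neg\phi(u)\|\to\|\neg\phi(v)\|$ for every formula $\phi(x)$ with at most $x$ free; $\|\neg(\varphi\vee\psi)\|=\|\neg\varphi\|\wedge\|\neg\psi\|$; $\|\neg(\varphi\wedge\psi)\|=\|\neg\varphi\|\vee\|\neg\psi\|$; $\|\neg(\varphi\to\psi)\|=\|\varphi\|\wedge\|\neg\psi\|$; $\|\exists x\varphi\|=\bigvee_{u}\|\varphi(u)\|$ and $\|\forall x\varphi\|=\bigwedge_{u}\|\varphi(u)\|$, $u$ ranging over $\mathbf{V}^{\langle A,N\rangle}$. A sentence $\varphi$ is valid in $\mathbf{V}^{\langle A,N\rangle}$ if $\|\varphi\|=1$. The set-theoretic axioms (schemas range over all formulas $\phi$ of the language, possibly containing $\neg$) are: Extensionality: $\forall x\forall y[\forall z(z\in x\leftrightarrow z\in y)\to x\approx y]$. Pairing: $\forall x\forall y\exists w\forall z[z\in w\leftrightarrow(z\approx x\vee z\approx y)]$. Collection: $\forall x[(\forall y\in x\,\exists z\,\phi(y,z))\to\exists w\,\forall y\in x\,\exists z\in w\,\phi(y,z)]$, $w$ not free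 in $\phi$. Powerset: $\forall x\exists w\forall z[z\in w\leftrightarrow\forall y\in z(y\in x)]$. Separation: $\forall x\exists w\forall z[z\in w\leftrightarrow(z\in x\wedge\phi(z))]$, $w$ not free in $\phi$. Empty set: $\exists x\forall z[z\in x\leftrightarrow((z\approx z)\to\bot)]$ (the unique such set is denoted $\emptyset$). Union: $\forall x\exists w\forall z[z\in w\leftrightarrow\exists y\in x(z\in y)]$. Infinity: $\exists x[\emptyset\in x\wedge\forall y\in x(y^+\in x)]$, where $y^+=y\cup\{y\}$. Regularity (Induction): $\forall x[(\forall y\in x\,\phi(y))\to\phi(x)]\to\forall x\,\phi(x)$, $y$ not free in $\phi(x)$. *)

(* Defs.v *)
From HB Require Import structures.
From mathcomp Require Import all_boot all_order.
From mathcomp Require Import all_classical.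

Set Implicit Arguments.
Unset Strict Implicit.
Unset Printing Implicit Defensive.

Import Order.Theory.
Local Open Scope classical_set_scope.
Local Open Scope order_scope.

(** * Complete and saturated N4-structures *)

HB.mixin Record TBLattice_isCompleteHeyting (d : Order.disp_t) T
    of Order.TBLattice d T := {
  himp : T -> T -> T;
  le_himp : forall a b c : T, (a <= himp b c) = (a `&` b <= c);
  supremums_neq0 : forall S : set T, supremums S !=set0 }.

#[short(type="completeHeytingType")]
HB.structure Definition CompleteHeyting (d : Order.disp_t) :=
  { T of TBLattice_isCompleteHeyting d T & Order.TBLattice d T }.

(* The default values make these the least, resp. greatest, element on the
   empty family, so that they are the join and the meet of every family. *)
Definition bigJoin d (A : completeHeytingType d) (S : set A) : A :=
  supremum \bot S.
Definition bigMeet d (A : completeHeytingType d) (S : set A) : A :=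
  infimum \top S.

Definition saturated (A : Type) (N : A -> set A) : Prop :=
  forall a, N a = setT.

(** * Models of set theory *)

(* Classes are arbitrary predicates: this is ZF for a universe V whose class
   functions are all the functions of the metatheory.  Foundation is stated
   as the principle of induction on membership. *)
Record zfModel := ZFModel {
  zf_sort :> Type;
  mem : zf_sort -> zf_sort -> Prop;
  zf_extensionality : forall x y,
    (forall z, mem z x <-> mem z y) -> x = y;
  zf_foundation : forall P : set zf_sort,
    (forall x, (forall y, mem y x -> P y) -> P x) -> forall x, P x;
  zf_pairing : forall x y, exists w, forall z, mem z w <-> z = x \/ z = y;
  zf_union : forall x, exists w,
    forall z, mem z w <-> exists2 y, mem y x & mem z y;
  zf_powerset : forall x, exists w,
    forall z, mem z w <-> forall y, mem y z -> mem y x;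
  zf_infinity : exists x,
    (exists2 e, mem e x & forall z, ~ mem z e) /\
    (forall y, mem y x ->
       exists2 s, mem s x & forall z, mem z s <-> mem z y \/ z = y);
  zf_separation : forall (P : set zf_sort) x, exists w,
    forall z, mem z w <-> mem z x /\ P z;
  zf_replacement : forall (R : zf_sort -> zf_sort -> Prop) x,
    (forall y z z', R y z -> R y z' -> z = z') ->
    exists w, forall z, mem z w <-> exists2 y, mem y x & R y z
}.

Section SetTheory.
Variable V : zfModel.
Implicit Types x y z a b p : V.

Definition is_set (P : set V) : Prop := exists x, forall z, mem z x <-> P z.

(* p is the Kuratowski pair {{a}, {a, b}}. *)
Definition is_pair p a b : Prop :=
  forall z, mem z p <-> (forall t, mem t z <-> t = a)
                     \/ (forall t, mem t z <-> t = a \/ t = b).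

(* The ordered pair (a, b) is an element of x. *)
Definition graph x a b : Prop := exists2 p, is_pair p a b & mem p x.

Definition is_function x : Prop :=
  (forall p, mem p x -> exists a b, is_pair p a b) /\
  (forall a b b', graph x a b -> graph x a b' -> b = b').

Definition dom x : set V := [set a | exists b, graph x a b].
Definition ran x : set V := [set b | exists a, graph x a b].

Definition transitive_set x : Prop :=
  forall y z, mem y x -> mem z y -> mem z x.

Definition is_ordinal x : Prop :=
  transitive_set x /\ forall y, mem y x -> transitive_set y.

End SetTheory.

(** * The class of names *)

Section Names.
Context (V : zfModel) (A : Type) (code : A -> V).

(* [stage xi x] means that x belongs to V_xi. *)
Inductive stage (xi x : V) : Prop :=
  Stage zeta of mem zeta xi & is_function x & ran x `<=` range code
    & (forall y, dom x y -> stage zeta y).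

Definition name : Type :=
  {x : V | exists2 xi, is_ordinal xi & stage xi x}.

(* [value v x a] means that x is in dom(v) and v(x) = a. *)
Definition value (v x : name) (a : A) : Prop :=
  graph (sval v) (sval x) (code a).

End Names.

(** * The language *)

Section Language.
Variable C : Type.

Inductive term := Var of nat | Cst of C.

Inductive formula :=
| Bot
| Mem of term & term
| Eqv of term & term
| Imp of formula & formula
| And of formula & formula
| Or of formula & formula
| Neg of formula
| Ex of nat & formula
| All of nat & formula.

Definition Iff (f g : formula) : formula := And (Imp f g) (Imp g f).
Definition ExIn (x : nat) (u : term) (f : formula) : formula :=
  Ex x (And (Mem (Var x) u) f).
Definition AllIn (x : nat) (u : term) (f : formula) : formula :=
  All x (Imp (Mem (Var x) u) f).

Definition term_fv (t : term) : seq nat := if t is Var x then [:: x] else [::].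

Fixpoint fv (f : formula) : seq nat :=
  match f with
  | Bot => [::]
  | Mem s t | Eqv s t => term_fv s ++ term_fv t
  | Imp g h | And g h | Or g h => fv g ++ fv h
  | Neg g => fv g
  | Ex x g | All x g => [seq y <- fv g | y != x]
  end.

Definition sentence (f : formula) : bool := fv f == [::].

Definition term_subst (x : nat) (r t : term) : term :=
  if t is Var y then if y == x then r else t else t.

(* Substitution of r for the free occurrences of x.  Bound variables are not
   renamed: there is no capture if r is a constant, or under [free_for]. *)
Fixpoint subst (x : nat) (r : term) (f : formula) : formula :=
  match f with
  | Bot => Bot
  | Mem s t => Mem (term_subst x r s) (term_subst x r t)
  | Eqv s t => Eqv (term_subst x r s) (term_subst x r t)
  | Imp g h => Imp (subst x r g) (subst x r h)
  | And g h => And (subst x r g) (subst x r h)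
  | Or g h => Or (subst x r g) (subst x r h)
  | Neg g => Neg (subst x r g)
  | Ex y g => if y == x then f else Ex y (subst x r g)
  | All y g => if y == x then f else All y (subst x r g)
  end.

(* No free occurrence of x is in the scope of a quantifier binding y. *)
Fixpoint free_for (y x : nat) (f : formula) : bool :=
  match f with
  | Bot | Mem _ _ | Eqv _ _ => true
  | Imp g h | And g h | Or g h => free_for y x g && free_for y x h
  | Neg g => free_for y x g
  | Ex z g | All z g => (x \notin fv f) || (z != y) && free_for y x g
  end.

Definition universal_closure (f : formula) : formula :=
  foldr All f (undup (fv f)).

End Language.

Arguments Bot {C}.
Arguments Var {C} _.
Coercion Var : nat >-> term.

Declare Scope formula_scope.
Delimit Scope formula_scope with F.
Bind Scope formula_scope with formula.

Notation "⊥" := Bot : formula_scope.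
Notation "s ∈ t" := (Mem s t) (at level 70) : formula_scope.
Notation "s ≈ t" := (Eqv s t) (at level 70) : formula_scope.
Notation "f ⋀ g" := (And f g) (at level 80, right associativity)
  : formula_scope.
Notation "f ⋁ g" := (Or f g) (at level 85, right associativity)
  : formula_scope.
Notation "f ⟶ g" := (Imp f g) (at level 90, right associativity)
  : formula_scope.
Notation "f ⟷ g" := (Iff f g) (at level 95) : formula_scope.
Notation "∀ x , f" := (All x f) (at level 200, x at level 9)
  : formula_scope.
Notation "∃ x , f" := (Ex x f) (at level 200, x at level 9)
  : formula_scope.
Notation "∀ x ∈ u , f" := (AllIn x u f) (at level 200, x at level 9)
  : formula_scope.
Notation "∃ x ∈ u , f" := (ExIn x u f) (at level 200, x at level 9)
  : formula_scope.

(* The quantifiers bind the displayed variables, which are arbitrary but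
   distinct; the schemas may have further free variables.  The defined terms
   of Infinity are eliminated through their defining properties. *)
Inductive ZF_N4_axiom (C : Type) : formula C -> Prop :=
| ax_extensionality (x y z : nat) of uniq [:: x; y; z] :
    ZF_N4_axiom (∀ x, ∀ y, ((∀ z, (z ∈ x ⟷ z ∈ y)) ⟶ x ≈ y))%F
| ax_pairing (x y z w : nat) of uniq [:: x; y; z; w] :
    ZF_N4_axiom (∀ x, ∀ y, ∃ w, ∀ z, (z ∈ w ⟷ (z ≈ x ⋁ z ≈ y)))%F
| ax_collection (x y z w : nat) (f : formula C)
    of uniq [:: x; y; z; w] & w \notin fv f :
    ZF_N4_axiom
      (∀ x, ((∀ y ∈ x, ∃ z, f) ⟶ (∃ w, ∀ y ∈ x, ∃ z ∈ w, f)))%F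
| ax_powerset (x y z w : nat) of uniq [:: x; y; z; w] :
    ZF_N4_axiom (∀ x, ∃ w, ∀ z, (z ∈ w ⟷ (∀ y ∈ z, (y ∈ x))))%F
| ax_separation (x z w : nat) (f : formula C)
    of uniq [:: x; z; w] & w \notin fv f :
    ZF_N4_axiom (∀ x, ∃ w, ∀ z, (z ∈ w ⟷ (z ∈ x ⋀ f)))%F
| ax_empty_set (x z : nat) of uniq [:: x; z] :
    ZF_N4_axiom (∃ x, ∀ z, (z ∈ x ⟷ (z ≈ z ⟶ ⊥)))%F
| ax_union (x y z w : nat) of uniq [:: x; y; z; w] :
    ZF_N4_axiom (∀ x, ∃ w, ∀ z, (z ∈ w ⟷ (∃ y ∈ x, (z ∈ y))))%F
| ax_infinity (x y z e s : nat) of uniq [:: x; y; z; e; s] :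
    ZF_N4_axiom
      (∃ x, ((∃ e ∈ x, ∀ z, (z ∈ e ⟷ (z ≈ z ⟶ ⊥)))
           ⋀ (∀ y ∈ x, ∃ s ∈ x, ∀ z, (z ∈ s ⟷ (z ∈ y ⋁ z ≈ y)))))%F
| ax_regularity (x y : nat) (f : formula C)
    of uniq [:: x; y] & y \notin fv f & free_for y x f :
    ZF_N4_axiom
      ((∀ x, ((∀ y ∈ x, subst x y f) ⟶ f)) ⟶ (∀ x, f))%F.

(** * Interpretation mappings *)

Section Interpretation.
Context (V : zfModel) (d : Order.disp_t) (A : completeHeytingType d)
        (code : A -> V) (N : A -> set A).
Local Notation name := (name code).
Local Notation formula := (formula name).
Implicit Types (u v w : name) (f g : formula) (x : nat).

Definition mem_values (I : formula -> A) u v : set A :=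
  [set r | exists w a, value v w a /\ r = a `&` I (Cst w ≈ Cst u)%F].

Definition sub_values (I : formula -> A) u v : set A :=
  [set r | exists w a, value u w a /\ r = himp a (I (Cst w ∈ Cst v)%F)].

(* The mapping is total on formulas, but only its values on sentences are
   constrained. *)
Record interpretation (I : formula -> A) : Prop := {
  interp_bot : I ⊥%F = \bot;
  interp_mem : forall u v,
    I (Cst u ∈ Cst v)%F = bigJoin (mem_values I u v);
  interp_eqv : forall u v,
    I (Cst u ≈ Cst v)%F =
      bigMeet (sub_values I u v) `&` bigMeet (sub_values I v u);
  interp_and : forall f g, sentence f -> sentence g ->
    I (f ⋀ g)%F = I f `&` I g;
  interp_or : forall f g, sentence f -> sentence g ->
    I (f ⋁ g)%F = I f `|` I g;
  interp_imp : forall f g, sentence f -> sentence g ->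
    I (f ⟶ g)%F = himp (I f) (I g);
  interp_neg : forall f, sentence f -> N (I f) (I (Neg f));
  interp_neg_neg : forall f, sentence f -> I (Neg (Neg f)) = I f;
  interp_neg_eqv : forall x f u v, {subset fv f <= [:: x]} ->
    I (Cst u ≈ Cst v)%F
      <= himp (I (Neg (subst x (Cst u) f))) (I (Neg (subst x (Cst v) f)));
  interp_neg_or : forall f g, sentence f -> sentence g ->
    I (Neg (f ⋁ g)%F) = I (Neg f) `&` I (Neg g);
  interp_neg_and : forall f g, sentence f -> sentence g ->
    I (Neg (f ⋀ g)%F) = I (Neg f) `|` I (Neg g);
  interp_neg_imp : forall f g, sentence f -> sentence g ->
    I (Neg (f ⟶ g)%F) = I f `&` I (Neg g);
  interp_ex : forall x f, {subset fv f <= [:: x]} ->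
    I (∃ x, f)%F = bigJoin (range (fun u => I (subst x (Cst u) f)));
  interp_all : forall x f, {subset fv f <= [:: x]} ->
    I (∀ x, f)%F = bigMeet (range (fun u => I (subst x (Cst u) f)))
}.

Definition valid (I : formula -> A) f : Prop := I f = \top.

End Interpretation.

(* Main.v *)
Require Import Defs.
From mathcomp Require Import all_boot all_order.
From mathcomp Require Import all_classical.

Set Implicit Arguments.
Unset Strict Implicit.
Unset Printing Implicit Defensive.

Import Order.Theory.
Local Open Scope classical_set_scope.
Local Open Scope order_scope.

Local Notation mem := Defs.mem.

(** Call [p <= val e f] forcing: the formula [f], with its free variables read
    in the environment [e], holds at [p].  In a complete Heyting algebra the
    clauses of an interpretation mapping then read as the rules of natural
    deduction (a join is eliminated, as an existential quantifier is, after
    passing to a smaller [q]), and every axiom is verified by an intuitionistic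
    argument about the names.  Three ingredients make these arguments work.

    - Leibniz' law [leibniz]: [p <= eqv u v] allows [u] to be replaced by [v]
      in any formula.  For atomic formulas this is reflexivity, symmetry and
      transitivity of [eqv], proved by induction on names.  For negated formulas
      it is one of the clauses of an interpretation mapping; this is why the
      schemas hold for formulas containing the strong negation, although the
      value of a negation is not determined by that of the negated formula.

    - Existence of names [name_of]: an [A]-valued function on a class of names
      that is a set of the model is itself given by a name.  The name is found
      by replacement, and its rank bounded by the union of ordinals bounding the
      ranks of the names in its domain.

    - [forces_comprehension]: a formula [f] in [z] defines a name as soon as its
      value at each [u] lies below the join of the [eqv w u] for [w] in a fixed
      set of names.  Pairing, Powerset, Separation, Empty set and Union are
      instances of it, and only the set of names has to be found.  For Powerset
      it is the set of names whose domain is contained in that of the given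
      name [X], because [u] is forced by [u ⊆ X] to be equal to the name
      [s |-> elt s u] on the domain of [X]; that these names form a set uses
      that [A] is one.

    Of the other axioms, Extensionality is the definition of [eqv], Collection
    holds because the values of a formula are all taken on a set of names (again
    because [A] is a set), Infinity is witnessed by the canonical name of an
    infinite set of the model, and Regularity is induction on names. *)

(** * Sets of the model *)

Section ModelSets.
Variable V : zfModel.
Implicit Types (x y z a b p : V) (P Q : set V).

Lemma is_set_mem x : is_set [set z : V | mem z x].
Proof. by exists x. Qed.

Lemma is_set_sub P Q : is_set P -> Q `<=` P -> is_set Q.
Proof.
move=> [x Px] QP; have [w Hw] := zf_separation Q x.
exists w => z; rewrite Hw Px; split=> [[]//|Qz]; split=> //; exact: QP.
Qed.

(** Replacement along [h]: the type [T], of codes or of names, is compared with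
    the model only through an injection into it. *)
Lemma is_set_image (T : Type) (h g : T -> V) (D : set T) :
  injective h -> is_set (h @` D) -> is_set (g @` D).
Proof.
move=> h_inj [x hx].
have [|w Hw] := zf_replacement (R := fun y z => exists2 t, h t = y & g t = z) x.
  by move=> y z z' [t <- <-] [t' /h_inj -> <-].
exists w => z; rewrite Hw; split.
  move=> [y /hx [t Dt <-] [t' /h_inj -> <-]]; by exists t.
by move=> [t Dt <-]; exists (h t); [apply/hx; exists t|exists t].
Qed.

Lemma is_set_bigcup (T : Type) (h : T -> V) (D : set T) (F : T -> set V) :
  injective h -> is_set (h @` D) -> (forall t, D t -> is_set (F t)) ->
  is_set (\bigcup_(t in D) F t).
Proof.
move=> h_inj hD FD.
have /choice [g Hg] : forall t, exists x, D t -> forall z, mem z x <-> F t z.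
  move=> t; have [/FD [x Hx]|nDt] := pselect (D t); first by exists x.
  by exists (h t) => /nDt.
have [y Hy] := is_set_image g h_inj hD.
have [w Hw] := zf_union y.
exists w => z; rewrite Hw; split.
  by move=> [_ /Hy [t Dt <-]] /(Hg _ Dt) Fz; exists t.
by move=> [t Dt Fz]; exists (g t); [apply/Hy; exists t|apply/(Hg _ Dt)].
Qed.

Lemma is_set2 x y : is_set [set x; y].
Proof. exact: zf_pairing. Qed.

Lemma is_set_setU P Q : is_set P -> is_set Q -> is_set (P `|` Q).
Proof.
move=> [x Px] [y Qy]; have [w Hw] := zf_pairing x y.
have [u Hu] := zf_union w; exists u => z; rewrite Hu; split.
  by move=> [t /Hw [->|->]]; [left; apply/Px|right; apply/Qy].
by move=> [/Px zx|/Qy zy]; [exists x|exists y] => //; apply/Hw; [left|right].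
Qed.

Lemma is_set_powerset P :
  is_set P -> is_set [set x : V | forall z, mem z x -> P z].
Proof.
move=> [x Px]; have [w Hw] := zf_powerset x; exists w => z; rewrite Hw.
by split=> H y /H /Px.
Qed.

Lemma mem_wf : well_founded (@mem V).
Proof. by apply: (@zf_foundation V) => x IH; apply: Acc_intro. Qed.

Lemma is_pair_exists a b : exists p, is_pair p a b.
Proof.
have [s Hs] := zf_pairing a a; have [t Ht] := zf_pairing a b.
have [p Hp] := zf_pairing s t; exists p => z; rewrite Hp.
have Es w : mem w s <-> w = a by rewrite Hs; split=> [[]|->] //; left.
split.
- by move=> [->|->]; [left|right].
- move=> [Hz|Hz]; [left|right]; apply: zf_extensionality => w; rewrite Hz.
  + by rewrite Es.
  + by rewrite Ht.
Qed.

Definition opair a b : V := sval (cid (is_pair_exists a b)).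

Lemma is_pairE p a b : is_pair p a b <-> p = opair a b.
Proof.
rewrite /opair; case: cid => q /= Hq; split=> [Hp|-> //].
by apply: zf_extensionality => z; rewrite Hp Hq.
Qed.

Lemma opair_inj a b a' b' : opair a b = opair a' b' -> a = a' /\ b = b'.
Proof.
move=> E; have H : is_pair (opair a b) a b by apply/is_pairE.
have H' : is_pair (opair a b) a' b' by apply/is_pairE.
have [s Hs] := zf_pairing a a; have [t Ht] := zf_pairing a b.
have Es w : mem w s <-> w = a by rewrite Hs; split=> [[]|->] //; left.
have sp : mem s (opair a b) by apply/H; left.
have tp : mem t (opair a b) by apply/H; right.
have [t' Ht'] := zf_pairing a' b'.
have tp' : mem t' (opair a b) by apply/H'; right.
(* [{a}] is an element of the pair, hence is [{a'}] or [{a', b'}]. *)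
have Ea : a = a'.
  case/H': sp => Hs'; first by apply/Hs'/Es.
  by apply/esym/Es/Hs'; left.
split=> //; subst a'.
have bt : b = a \/ b = b'.
  by case/H': tp => Ht''; [left|]; apply/Ht''/Ht; right.
have bt' : b' = a \/ b' = b.
  by case/H: tp' => Ht''; [left|]; apply/Ht''/Ht'; right.
by case: bt => // ?; case: bt' => // ->.
Qed.

Lemma graphE x a b : graph x a b <-> mem (opair a b) x.
Proof.
split=> [[p /is_pairE -> //]|abx]; exists (opair a b) => //; exact/is_pairE.
Qed.

Lemma is_set_dom x : is_set (dom x).
Proof.
have [|w Hw] :=
  zf_replacement (R := fun p a => exists b, p = opair a b) x.
  by move=> _ a a' [b ->] [b' /opair_inj []].
exists w => a; rewrite Hw; split.
  by move=> [p px [b Ep]]; exists b; apply/graphE; rewrite -Ep.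
by move=> [b /graphE abx]; exists (opair a b) => //; exists b.
Qed.

Lemma is_set_prod P Q : is_set P -> is_set Q ->
  is_set [set p : V | exists a b, [/\ P a, Q b & p = opair a b]].
Proof.
move=> setP setQ.
have imid R : is_set R -> is_set (@id V @` R) by rewrite image_id.
apply: (@is_set_sub (\bigcup_(a in P) (opair a @` Q))).
  apply: (is_set_bigcup (h := id)) => // [|a _]; first exact: imid.
  by apply: (is_set_image (h := id)) => //; exact: imid.
by move=> p [a [b [Pa Qb ->]]]; exists a => //; exists b.
Qed.

(** [zeta] is the union of the ordinals [xi t] and [eta] its successor: with
    inclusion in place of a comparison of ordinals, both are ordinals because
    they and their elements are transitive. *)
Lemma ordinal_bound (T : Type) (h xi : T -> V) (D : set T) :
  injective h -> is_set (h @` D) -> (forall t, D t -> is_ordinal (xi t)) ->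
  exists zeta eta, [/\ is_ordinal eta, mem zeta eta &
    forall t z, D t -> mem z (xi t) -> mem z zeta].
Proof.
move=> h_inj hD ordD.
have [zeta Hz] := is_set_bigcup (F := fun t => [set z : V | mem z (xi t)])
  h_inj hD (fun t _ => is_set_mem (xi t)).
have [eta He] := is_set_setU (is_set_mem zeta) (is_set2 zeta zeta).
have He' z : mem z eta <-> mem z zeta \/ z = zeta.
  by rewrite He /=; split=> -[?|]; [left|move=> []; right|left|right; left].
have zetaT : transitive_set zeta.
  move=> y z /Hz [t Dt yt] zy; apply/Hz; exists t => //=.
  by have [trt _] := ordD t Dt; apply: trt zy.
exists zeta, eta; split; last by move=> t z Dt zt; apply/Hz; exists t.
- split.
  + move=> y z /He' [yz|->] zy; apply/He'; left => //.
    exact: zetaT zy.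
  + move=> y /He' [/Hz [t Dt yt]|-> //].
    by have [_] := ordD t Dt; apply.
- by apply/He'; right.
Qed.

End ModelSets.

(** * Names *)

Section NameTheory.
Context (V : zfModel) (A : Type) (code : A -> V).
Hypothesis code_inj : injective code.
Hypothesis code_set : is_set (range code).
Local Notation name := (name code).
Implicit Types (u v w : name) (D : set name).

Lemma sval_name_inj : injective (fun u : name => sval u).
Proof.
by move=> [x Hx] [y Hy] /= E; subst y; rewrite (Prop_irrelevance Hx Hy).
Qed.

Lemma ordinal_mem (xi zeta : V) : is_ordinal xi -> mem zeta xi -> is_ordinal zeta.
Proof.
move=> [tr elt] zx; split; first exact: elt.
by move=> y yz; apply: elt; apply: tr yz.
Qed.

Lemma graph_name u (x b : V) : graph (sval u) x b ->
  exists w a, x = sval w /\ b = code a.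
Proof.
case: u => u [xi oxi [zeta zx fu ru du]] /= ub.
have [|a _ Ea] := ru b; first by exists x.
have sx : stage code zeta x by apply: du; exists b.
have Hx : exists2 xi, is_ordinal xi & stage code xi x.
  by exists zeta => //; apply: ordinal_mem zx.
by exists (exist _ x Hx), a.
Qed.

Lemma name_ind (P : name -> Prop) :
  (forall v, (forall w a, value v w a -> P w) -> P v) -> forall v, P v.
Proof.
move=> IH v.
have H (xi x : V) : stage code xi x -> forall v, sval v = x -> P v.
  elim=> {v}{}xi {}x zeta _ _ _ _ IHx v Ev; apply: IH => w a va.
  by apply: (IHx (sval w)) => //; exists (code a); rewrite -Ev.
by case: (svalP v) => xi _ /H; apply.
Qed.

Definition small D : Prop := is_set ((fun w : name => sval w) @` D).

Lemma small_image (T : Type) (h : T -> V) (g : T -> name) (D : set T) :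
  injective h -> is_set (h @` D) -> small (g @` D).
Proof. by rewrite /small image_comp; apply: is_set_image. Qed.

Lemma small_bigcup (T : Type) (h : T -> V) (D : set T) (F : T -> set name) :
  injective h -> is_set (h @` D) -> (forall t, D t -> small (F t)) ->
  small (\bigcup_(t in D) F t).
Proof. by rewrite /small image_bigcup; apply: is_set_bigcup. Qed.

Lemma small0 : small set0.
Proof.
rewrite /small image_set0; have [x _] := zf_infinity V.
exact: is_set_sub (is_set_mem x) _.
Qed.

Lemma small2 u v : small [set u; v].
Proof.
apply: (is_set_sub (is_set2 (sval u) (sval v))).
by move=> _ [w [->|->] <-]; [left|right].
Qed.

Definition ndom v : set name := [set w | exists a, value v w a].

Lemma small_ndom v : small (ndom v).
Proof.
apply: (is_set_sub (is_set_dom (sval v))).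
by move=> _ [w [a va] <-]; exists (code a).
Qed.

(** A name with domain contained in that of [v] is a subset of the product of
    this domain by [range code], so that powerset applies. *)
Lemma small_ndom_sub v : small [set w | ndom w `<=` ndom v].
Proof.
apply: (is_set_sub
  (is_set_powerset (is_set_prod (small_ndom v) code_set))).
move=> _ [w wv <-] p pw.
have [_ _ [_ _ [pairs _] _ _]] := svalP w.
have [x [b /is_pairE Ep]] := pairs p pw; subst p.
have [t [a [Ex Eb]]] := graph_name (proj2 (graphE _ _ _) pw); subst x b.
exists (sval t), (code a); split=> //.
by exists t => //; apply: wv; exists a; apply/graphE.
Qed.

(** The ranks of the names in [D] are bounded by ordinals chosen one by one;
    [D] being small, these have a common bound, which gives the rank of the new
    name. *)
Lemma name_of D (val : name -> A) : small D ->
  exists v, forall w a, value v w a <-> D w /\ a = val w.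
Proof.
move=> sD.
have [x Hx] :=
  is_set_image (fun w => opair (sval w) (code (val w))) sval_name_inj sD.
have xE b c : graph x b c <-> exists w, [/\ D w, b = sval w & c = code (val w)].
  rewrite graphE Hx; split=> [[w Dw /opair_inj[<- <-]]|[w [Dw -> ->]]];
  by exists w.
have /choice [xi Hxi] (w : name) :
    exists xi, is_ordinal xi /\ stage code xi (sval w).
  by have [xi] := svalP w; exists xi.
have [zeta [eta [oeta ze Hz]]] :=
  ordinal_bound (D := D) sval_name_inj sD (fun w _ => (Hxi w).1).
have sx : stage code eta x.
  exists zeta => //.
  - split=> [p /Hx[w _ <-]|b c c' /xE[w [_ Ew ->]] /xE[w' [_ Ew' ->]]].
      by exists (sval w), (code (val w)); apply/is_pairE.
    by rewrite (sval_name_inj (etrans (esym Ew) Ew')).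
  - by move=> _ [b /xE[w [_ _ ->]]]; exists (val w).
  - move=> _ [c /xE[w [Dw -> _]]].
    have [_ [t tw f r d]] := Hxi w; exists t => //; exact: Hz tw.
have Hname : exists2 xi, is_ordinal xi & stage code xi x by exists eta.
exists (exist _ x Hname) => w a; rewrite /value /= xE; split.
  by move=> [w' [Dw' /sval_name_inj -> /code_inj ->]].
by move=> [Dw ->]; exists w.
Qed.

(** The canonical names of the elements of the model, by recursion on
    membership; the canonical name of an infinite set is a witness for
    Infinity. *)
Lemma check_names (a : A) : exists check : V -> name,
  forall (x : V) w b,
  value (check x) w b <-> (exists2 z : V, mem z x & w = check z) /\ b = a.
Proof.
have ex (x : V) (rec : forall z : V, mem z x -> name) : exists v, forall w b,
    value v w b <-> (exists z (zx : mem z x), w = rec z zx) /\ b = a.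
  apply: (@name_of [set w | exists z zx, w = rec z zx] (fun=> a)).
  have -> : [set w | exists z zx, w = rec z zx] =
      range (fun s : {z | mem z x} => let: exist z zx := s in rec z zx).
    apply/seteqP; split=> w; first by move=> [z [zx ->]]; exists (exist _ z zx).
    by move=> [[z zx] _ <-]; exists z, zx.
  apply: (@small_image _ (fun s : {z | mem z x} => sval s)).
    by move=> [z zx] [z' zx'] /= E; subst z'; rewrite (Prop_irrelevance zx zx').
  apply: (is_set_sub (is_set_mem x)); by move=> _ [[z zx] _ <-].
pose F (x : V) rec : name := sval (cid (ex x rec)).
exists (Fix (@mem_wf V) (fun=> name) F) => x w b.
rewrite Fix_eq; last first.
  move=> {}x f g fg; have -> // : f = g.
  by apply: functional_extensionality_dep => z; apply/funext => zx; exact: fg.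
rewrite /F; case: cid => v /= ->.
by split=> -[H ->]; split=> //; case: H => z; [move=> [zx ->]|move=> zx ->];
  exists z => //; exists zx.
Qed.

End NameTheory.

(** * Joins and meets in a complete Heyting algebra *)

Section CompleteHeyting.
Context (d : Order.disp_t) (A : completeHeytingType d).
Implicit Types (a b c p q : A) (S : set A).

Lemma bigJoin_supremums S : supremums S (bigJoin S).
Proof.
rewrite /bigJoin /supremum; case: eqP => [->|_].
  by split=> [a []|a _]; exact: le0x.
exact: xgetPex (supremums_neq0 S).
Qed.

Lemma le_bigJoin S a : S a -> a <= bigJoin S.
Proof. by have [H _] := bigJoin_supremums S; exact: H. Qed.

Lemma le_bigMeet S c : c <= bigMeet S <-> forall a, S a -> c <= a.
Proof.
rewrite /bigMeet /infimum; case: eqP => [->|_].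
  by split=> [_ a []|_]; exact: lex1.
have [lb glb] : infimums S (xget \top (infimums S)).
  apply: xgetPex; have [b [ub lub]] := supremums_neq0 (lbound S).
  exists b; split=> [a Sa|//].
  by apply: lub => c'; apply.
split=> [cS a Sa|]; last exact: glb.
exact: le_trans cS (lb a Sa).
Qed.

Lemma le_himp_elim p a b : p <= himp a b -> p <= a -> p <= b.
Proof. by rewrite le_himp => + pa; rewrite (meet_l pa). Qed.

(** Joins are eliminated as existential quantifiers are, because the meet
    distributes over them: [bigJoin S <= himp p c] as soon as [a `&` p <= c] for
    every [a] in [S]. *)
Lemma bigJoin_elim S p c : p <= bigJoin S ->
  (forall q a, q <= p -> S a -> q <= a -> q <= c) -> p <= c.
Proof.
move=> pS H; suff: bigJoin S <= himp p c.
  by move=> Sc; apply: le_himp_elim (le_trans pS Sc) _.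
have [_ lub] := bigJoin_supremums S; apply: lub => a Sa.
by rewrite le_himp; apply: (H _ a) => //; [exact: leIr|exact: leIl].
Qed.

Lemma join_elim p a b c : p <= a `|` b ->
  (forall q, q <= p -> q <= a -> q <= c) ->
  (forall q, q <= p -> q <= b -> q <= c) -> p <= c.
Proof.
move=> pab Ha Hb; suff: a `|` b <= himp p c.
  by move=> Sc; apply: le_himp_elim (le_trans pab Sc) _.
by rewrite leUx !le_himp Ha ?Hb ?leIl ?leIr.
Qed.

End CompleteHeyting.

(** * Instantiation of the free variables *)

Section Instantiation.
Variable C : Type.
Implicit Types (t : term C) (f g : formula C) (r : nat -> option C).

Definition upd (T : Type) (e : nat -> T) (x : nat) (u : T) : nat -> T :=
  fun i => if i == x then u else e i.

Lemma upd_same (T : Type) (e : nat -> T) x u : upd e x u x = u.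
Proof. by rewrite /upd eqxx. Qed.

Lemma upd_other (T : Type) (e : nat -> T) x u y : y != x -> upd e x u y = e y.
Proof. by rewrite /upd => /negPf ->. Qed.

Lemma updC (T : Type) (e : nat -> T) x y u v : x != y ->
  upd (upd e x u) y v = upd (upd e y v) x u.
Proof.
move=> xy; apply/funext => i; rewrite /upd.
by case: (i =P x) => [->|//]; rewrite (negPf xy).
Qed.

Lemma upd_upd (T : Type) (e : nat -> T) x u v : upd (upd e x u) x v = upd e x v.
Proof. by apply/funext => i; rewrite /upd; case: eqP. Qed.

Definition term_inst r t : term C :=
  if t is Var i then (if r i is Some c then Cst c else t) else t.

(** Simultaneous substitution of constants for the variables on which [r] is
    defined.  The clauses of an interpretation mapping concern sentences, whose
    subformulas are not sentences; partial instances make an induction on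
    formulas possible. *)
Fixpoint inst r f : formula C :=
  match f with
  | Bot => Bot
  | (s ∈ t)%F => Defs.Mem (term_inst r s) (term_inst r t)
  | Eqv s t => Eqv (term_inst r s) (term_inst r t)
  | Imp g h => Imp (inst r g) (inst r h)
  | And g h => And (inst r g) (inst r h)
  | Or g h => Or (inst r g) (inst r h)
  | Neg g => Neg (inst r g)
  | Ex x g => Ex x (inst (upd r x None) g)
  | All x g => All x (inst (upd r x None) g)
  end.

Lemma eq_term_inst r r' t :
  {in term_fv t, r =1 r'} -> term_inst r t = term_inst r' t.
Proof. by case: t => //= i -> //; rewrite inE. Qed.

Lemma eq_inst r r' f : {in fv f, r =1 r'} -> inst r f = inst r' f.
Proof.
elim: f r r' => //= [s t|s t|g IHg h IHh|g IHg h IHh|g IHg h IHh|g IHg|x g IHg|x g IHg]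
  r r' rr'.
1-2: by rewrite !(@eq_term_inst r r') // => i Hi; apply: rr';
  rewrite mem_cat Hi ?orbT.
1-3: by rewrite (IHg r r') ?(IHh r r') // => i Hi; apply: rr';
  rewrite mem_cat Hi ?orbT.
- by rewrite (IHg r r').
all: rewrite (IHg _ (upd r' x None)) // => i gi; rewrite /upd.
all: by case: eqP => // /eqP ix; apply: rr'; rewrite mem_filter ix.
Qed.

Lemma inst_None f : inst (fun=> None) f = f.
Proof.
have upd0 x : upd (fun=> @None C) x None = fun=> None.
  by apply/funext => i; rewrite /upd if_same.
elim: f => //= [[?|?] [?|?]|[?|?] [?|?]|g -> h ->|g -> h ->|g -> h ->|g ->|x g|x g] //;
  by rewrite upd0 => ->.
Qed.

Lemma term_fv_inst r t i :
  (i \in term_fv (term_inst r t)) = (i \in term_fv t) && ~~ r i.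
Proof.
case: t => //= j; case E: (r j) => [c|] /=; rewrite ?inE.
  by case: eqP => [->|]; rewrite ?E.
by case: eqP => [->|]; rewrite ?E.
Qed.

Lemma fv_inst r f i : (i \in fv (inst r f)) = (i \in fv f) && ~~ r i.
Proof.
elim: f r => //= [s t|s t|g IHg h IHh|g IHg h IHh|g IHg h IHh|x g IHg|x g IHg] r.
1-5: by rewrite !mem_cat ?term_fv_inst ?IHg ?IHh andb_orl.
all: rewrite !mem_filter IHg /upd; by case: eqP.
Qed.

Lemma subst_inst x u r f : r x = None ->
  subst x (Cst u) (inst r f) = inst (upd r x (Some u)) f.
Proof.
have tE s t : s x = None ->
    term_subst x (Cst u) (term_inst s t) = term_inst (upd s x (Some u)) t.
  case: t => //= i sx; rewrite /upd; case: (i =P x) => [->|/eqP/negPf ix].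
    by rewrite sx /= eqxx.
  by case: (s i) => //=; rewrite ix.
elim: f r => //= [s t|s t|g IHg h IHh|g IHg h IHh|g IHg h IHh|g IHg|y g IHg|y g IHg] r rx.
1-6: by rewrite ?tE ?IHg ?IHh.
all: case: (y =P x) => [->|/eqP yx]; first by rewrite upd_upd.
all: by rewrite IHg ?(updC _ _ _ yx) // /upd; case: eqP.
Qed.

Lemma subst_id x t f : x \notin fv f -> subst x t f = f.
Proof.
have tE s : x \notin term_fv s -> term_subst x t s = s.
  by case: s => //= i; rewrite inE eq_sym => /negPf ->.
elim: f => //= [s s'|s s'|g IHg h IHh|g IHg h IHh|g IHg h IHh|g IHg|y g IHg|y g IHg].
1-5: by rewrite mem_cat negb_or => /andP[? ?]; rewrite ?tE ?IHg ?IHh.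
- by move=> /IHg ->.
all: rewrite mem_filter negb_and negbK eq_sym.
all: by case: eqP => //= _ /IHg ->.
Qed.

(** As [free_for] excludes the capture of [y], each occurrence of [y] introduced
    by the substitution is still free, and is read as the constant given by
    [r]. *)
Lemma inst_subst_var x y c r f : free_for y x f -> r y = Some c ->
  inst r (subst x (Var y) f) = inst (upd r x (Some c)) f.
Proof.
have tE s t : s y = Some c ->
    term_inst s (term_subst x (Var y) t) = term_inst (upd s x (Some c)) t.
  by case: t => //= i sy; rewrite /upd; case: eqP => //= _; rewrite sy.
have out s g : x \notin fv g ->
    inst s (subst x (Var y) g) = inst (upd s x (Some c)) g.
  move=> xg; rewrite subst_id //; apply: eq_inst => i gi; rewrite /upd.
  by case: eqP => // E; rewrite -E gi in xg.
elim: f r => //= [s t|s t|g IHg h IHh|g IHg h IHh|g IHg h IHh|g IHg|z g IHg|z g IHg] r.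
1-2: by move=> _ ry; rewrite !tE.
1-3: by move=> /andP[? ?] ry; rewrite IHg ?IHh.
- by move=> ? ry; rewrite IHg.
all: case: (z =P x) => [-> _ _|/eqP zx /=]; first by rewrite upd_upd.
all: rewrite mem_filter negb_and negbK eq_sym (negPf zx) /= => H ry.
all: rewrite -(updC _ _ _ zx); have [/out -> //|xg] := boolP (x \notin fv g).
all: move: H; rewrite (negPf xg) /= => /andP[zy gy]; rewrite IHg //.
all: by rewrite /upd eq_sym (negPf zy).
Qed.

Lemma sentence_inst e f : sentence (inst (fun i => Some (e i)) f).
Proof.
rewrite /sentence; case E: (fv _) => [//|i s].
have := mem_head i s; rewrite -E fv_inst andbF //.
Qed.

Lemma fv_inst_upd x e f :
  {subset fv (inst (upd (fun i => Some (e i)) x None) f) <= [:: x]}.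
Proof. by move=> i; rewrite fv_inst inE /upd; case: eqP; rewrite ?andbF. Qed.

Lemma subst_inst_upd x u e f :
  subst x (Cst u) (inst (upd (fun i => Some (e i)) x None) f)
    = inst (fun i => Some (upd e x u i)) f.
Proof.
rewrite subst_inst /upd ?eqxx //; apply: eq_inst => i _.
by rewrite /upd; case: eqP.
Qed.

Definition term_val (e : nat -> C) t : C :=
  match t with Var i => e i | Cst c => c end.

Lemma term_inst_val e t :
  term_inst (fun i => Some (e i)) t = Cst (term_val e t).
Proof. by case: t. Qed.

End Instantiation.

(** * Forcing over the names *)

Section Forcing.
Context (V : zfModel) (d : Order.disp_t) (A : completeHeytingType d).
Context (code : A -> V) (code_inj : injective code).
Context (code_set : is_set (range code)).
Context (N : A -> set A) (I : formula (name code) -> A).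
Hypothesis I_interp : interpretation N I.
Local Notation name := (name code).
Local Notation formula := (formula name).
Implicit Types (u v w : name) (f g : formula) (x y z : nat) (e : nat -> name).
Implicit Types (a b c p q : A).

Definition val e f : A := I (inst (fun i => Some (e i)) f).

Local Notation "p ⊩[ e ] f" := (p <= val e f)
  (at level 70, e at level 50, f at level 69, format "p  ⊩[ e ]  f").

Definition eqv u v : A := I (Cst u ≈ Cst v)%F.
Definition elt u v : A := I (Cst u ∈ Cst v)%F.

Lemma val_bot e : val e ⊥%F = \bot.
Proof. exact: interp_bot I_interp. Qed.

Lemma val_mem e s t : val e (s ∈ t)%F = elt (term_val e s) (term_val e t).
Proof. by rewrite /val /= !term_inst_val. Qed.

Lemma val_eqv e s t : val e (s ≈ t)%F = eqv (term_val e s) (term_val e t).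
Proof. by rewrite /val /= !term_inst_val. Qed.

Lemma val_and e f g : val e (f ⋀ g)%F = val e f `&` val e g.
Proof. by rewrite /val /= (interp_and I_interp) //; exact: sentence_inst. Qed.

Lemma val_or e f g : val e (f ⋁ g)%F = val e f `|` val e g.
Proof. by rewrite /val /= (interp_or I_interp) //; exact: sentence_inst. Qed.

Lemma val_imp e f g : val e (f ⟶ g)%F = himp (val e f) (val e g).
Proof. by rewrite /val /= (interp_imp I_interp) //; exact: sentence_inst. Qed.

Lemma val_ex e x f :
  val e (∃ x, f)%F = bigJoin (range (fun u => val (upd e x u) f)).
Proof.
rewrite /val /= (interp_ex I_interp); last exact: fv_inst_upd.
by congr (bigJoin (_ @` _)); apply/funext => u; rewrite subst_inst_upd.
Qed.

Lemma val_all e x f :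
  val e (∀ x, f)%F = bigMeet (range (fun u => val (upd e x u) f)).
Proof.
rewrite /val /= (interp_all I_interp); last exact: fv_inst_upd.
by congr (bigMeet (_ @` _)); apply/funext => u; rewrite subst_inst_upd.
Qed.

Lemma eq_val e e' f : {in fv f, e =1 e'} -> val e f = val e' f.
Proof. by move=> ee'; rewrite /val (@eq_inst _ _ (fun i => Some (e' i))) // => i /ee' ->. Qed.

Lemma val_upd_out e x u f : x \notin fv f -> val (upd e x u) f = val e f.
Proof.
move=> xf; apply: eq_val => i fi; rewrite /upd.
by case: eqP => // E; rewrite -E fi in xf.
Qed.

Lemma val_subst_var e x y f : free_for y x f ->
  val e (subst x (Var y) f) = val (upd e x (e y)) f.
Proof.
move=> yx; rewrite /val (inst_subst_var yx erefl); congr I.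
by apply: eq_inst => i _; rewrite /upd; case: eqP.
Qed.

Lemma forces_imp p e f g :
  p ⊩[e] (f ⟶ g) <-> (forall q, q <= p -> q ⊩[e] f -> q ⊩[e] g).
Proof.
rewrite val_imp; split=> [H q qp|H].
  by apply: le_himp_elim; exact: le_trans qp H.
by rewrite le_himp; apply: H; [exact: leIl|exact: leIr].
Qed.

Lemma forces_and p e f g : p ⊩[e] (f ⋀ g) <-> p ⊩[e] f /\ p ⊩[e] g.
Proof. by rewrite val_and lexI; split=> /andP. Qed.

Lemma forces_orl p e f g : p ⊩[e] f -> p ⊩[e] (f ⋁ g).
Proof. by move=> H; rewrite val_or lexU2 ?H. Qed.

Lemma forces_orr p e f g : p ⊩[e] g -> p ⊩[e] (f ⋁ g).
Proof. by move=> H; rewrite val_or lexU2 ?H ?orbT. Qed.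

Lemma forces_or_elim p e f g c : p ⊩[e] (f ⋁ g) ->
  (forall q, q <= p -> q ⊩[e] f -> q <= c) ->
  (forall q, q <= p -> q ⊩[e] g -> q <= c) -> p <= c.
Proof. by rewrite val_or; exact: join_elim. Qed.

Lemma forces_iff p e f g : p ⊩[e] (f ⟷ g) <->
  (forall q, q <= p -> q ⊩[e] f <-> q ⊩[e] g).
Proof.
rewrite forces_and !forces_imp; split=> [[H H'] q qp|H].
  by split; [exact: H|exact: H'].
by split=> q qp; have [] := H q qp.
Qed.

Lemma forces_all p e x f : p ⊩[e] (∀ x, f) <-> forall u, p ⊩[upd e x u] f.
Proof.
rewrite val_all le_bigMeet; split=> [H u|H _ [u _ <-] //].
by apply: H; exists u.
Qed.

Lemma forces_ex u p e x f : p ⊩[upd e x u] f -> p ⊩[e] (∃ x, f).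
Proof. by move=> pf; rewrite val_ex (le_trans pf) ?le_bigJoin //; exists u. Qed.

Lemma forces_ex_elim p e x f c : p ⊩[e] (∃ x, f) ->
  (forall q u, q <= p -> q ⊩[upd e x u] f -> q <= c) -> p <= c.
Proof.
rewrite val_ex => pf H; apply: bigJoin_elim pf _ => q _ qp [u _ <-]; exact: H.
Qed.

(** ** Equality and membership of names *)

Lemma elt_intro p u v w a : value v w a -> p <= a -> p <= eqv w u -> p <= elt u v.
Proof.
move=> va pa pE; rewrite /elt (interp_mem I_interp).
apply: (@le_trans _ _ (a `&` eqv w u)); first by rewrite lexI pa.
by apply: le_bigJoin; exists w, a.
Qed.

Lemma elt_elim p u v c : p <= elt u v ->
  (forall q w a, q <= p -> value v w a -> q <= a -> q <= eqv w u -> q <= c) ->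
  p <= c.
Proof.
rewrite /elt (interp_mem I_interp) => pM H; apply: bigJoin_elim pM _.
by move=> q _ qp [w [a [va ->]]]; rewrite lexI => /andP[]; exact: H qp va.
Qed.

Lemma le_eqv p u v : p <= eqv u v <->
  (forall q w a, q <= p -> value u w a -> q <= a -> q <= elt w v) /\
  (forall q w a, q <= p -> value v w a -> q <= a -> q <= elt w u).
Proof.
have sub u' v' : p <= bigMeet (sub_values I u' v') <->
    (forall q w a, q <= p -> value u' w a -> q <= a -> q <= elt w v').
  rewrite le_bigMeet; split=> [H q w a qp uw|H _ [w [a [uw ->]]]].
    by apply/le_himp_elim/(le_trans qp)/H; exists w, a.
  by rewrite le_himp; apply: (H _ w a); rewrite ?leIl ?leIr.
rewrite /eqv (interp_eqv I_interp) lexI -!sub; split=> /andP //.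
Qed.

Lemma eqv_refl p u : p <= eqv u u.
Proof.
elim/name_ind: u p => u IH p.
by apply/le_eqv; split=> q w a _ uw qa; apply: (elt_intro uw qa); exact: IH uw q.
Qed.

Lemma eqvC u v : eqv u v = eqv v u.
Proof. by rewrite /eqv !(interp_eqv I_interp) meetC. Qed.

Lemma elt_value p v w a : value v w a -> p <= a -> p <= elt w v.
Proof. by move=> vw pa; apply: (elt_intro vw pa); exact: eqv_refl. Qed.

Lemma eqv_elim p u v w a : p <= eqv u v -> value u w a -> p <= a -> p <= elt w v.
Proof. by move=> /le_eqv[H _] uw; apply: H uw. Qed.

(** By induction on [u], for all [v] and [w]: in both inclusions, a member of
    one of [u] and [w] is matched with one of [v] and then with one of the other,
    so that transitivity is needed for a member of [u] only. *)
Lemma eqv_trans p u v w : p <= eqv u v -> p <= eqv v w -> p <= eqv u w.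
Proof.
elim/name_ind: u p v w => u IH p v w uv vw.
apply/le_eqv; split=> q t a qp.
  move=> ut qa; have tv := eqv_elim (le_trans qp uv) ut qa.
  apply: elt_elim tv _ => r s b rq vs rb rst.
  have := eqv_elim (le_trans (le_trans rq qp) vw) vs rb.
  move=> sw; apply: elt_elim sw _ => r' s' b' r'r ws r'b r's.
  apply: (elt_intro ws r'b); rewrite eqvC; apply: (IH _ _ ut _ s).
    by rewrite eqvC (le_trans r'r).
  by rewrite eqvC.
move=> wt qa; have : q <= eqv w v by rewrite eqvC (le_trans qp).
move=> /eqv_elim /(_ wt qa) tv.
apply: elt_elim tv _ => r s b rq vs rb rst.
have : r <= eqv v u by rewrite eqvC (le_trans rq) ?(le_trans qp).
move=> /eqv_elim /(_ vs rb) su.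
apply: elt_elim su _ => r' s' b' r'r us r'b r's.
apply: (elt_intro us r'b); apply: (IH _ _ us _ s) => //.
exact: le_trans r'r rst.
Qed.

Lemma elt_eqv p u u' v v' :
  p <= eqv u u' -> p <= eqv v v' -> p <= elt u v -> p <= elt u' v'.
Proof.
move=> uu' vv' uv; apply: elt_elim uv _ => q w a qp vw qa qwu.
have wv' := eqv_elim (le_trans qp vv') vw qa.
apply: elt_elim wv' _ => r s b rq v's rb rsw.
apply: (elt_intro v's rb); apply: eqv_trans rsw _.
apply: (eqv_trans (le_trans rq qwu)); exact: le_trans rq (le_trans qp uu').
Qed.

(** By induction on [f], except below negations: the value of [Neg f] is not a
    function of that of [f], and the law for it is a clause of [interpretation].
    Implications use the symmetry of [eqv] for their premise. *)
Lemma leibniz p e x u v f :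
  p <= eqv u v -> p ⊩[upd e x u] f -> p ⊩[upd e x v] f.
Proof.
have tE q e' u' v' t : q <= eqv u' v' ->
    q <= eqv (term_val (upd e' x u') t) (term_val (upd e' x v') t).
  move=> uv; case: t => [i|c] /=; last exact: eqv_refl.
  by rewrite /upd; case: eqP => // _; exact: eqv_refl.
elim: f p e u v => [|s t|s t|g IHg h IHh|g IHg h IHh|g IHg h IHh|g IHg|y g IHg|y g IHg]
  p e u v uv.
- by rewrite !val_bot.
- by rewrite !val_mem; apply: elt_eqv; exact: tE.
- rewrite !val_eqv => H; apply: eqv_trans (eqv_trans _ H) _; last exact: tE.
  by rewrite eqvC; exact: tE.
- move=> /forces_imp H; apply/forces_imp => q qp qg.
  have quv := le_trans qp uv; apply: (IHh _ _ _ _ quv); apply: H => //.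
  by apply: IHg qg; rewrite eqvC.
- by move=> /forces_and[Hg Hh]; apply/forces_and; split; [apply: IHg Hg|apply: IHh Hh].
- move=> H; apply: forces_or_elim H _ _ => q qp H.
    by apply/forces_orl; apply: IHg H; exact: le_trans uv.
  by apply/forces_orr; apply: IHh H; exact: le_trans uv.
- rewrite /val /= -!subst_inst_upd => H.
  (* The clause for negations concerns a formula with [x] as only free variable:
     the instance of [g] by [e] away from [x]. *)
  apply: le_himp_elim H; apply: le_trans uv _.
  by have := interp_neg_eqv I_interp u v (@fv_inst_upd _ x e g).
- move=> H; apply: forces_ex_elim H _ => q w qp H; apply: (@forces_ex w).
  move: H; have [<-|xy] := eqVneq x y; first by rewrite !upd_upd.
  by rewrite !(updC _ _ _ xy); apply: IHg; exact: le_trans uv.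
- move=> /forces_all H; apply/forces_all => w; move: (H w).
  have [<-|xy] := eqVneq x y; first by rewrite !upd_upd.
  by rewrite !(updC _ _ _ xy); apply: IHg.
Qed.

(** ** Bounded quantifiers *)

Lemma forces_allin p e y t f : p ⊩[e] (∀ y ∈ t, f) <->
  forall u q, q <= p -> q <= elt u (term_val (upd e y u) t) -> q ⊩[upd e y u] f.
Proof.
have yE u : term_val (upd e y u) (Var y) = u by rewrite /= /upd eqxx.
rewrite forces_all; split=> H u.
  by move=> q qp qt; move/forces_imp: (H u); apply=> //; rewrite val_mem yE.
by apply/forces_imp => q qp; rewrite val_mem yE; exact: H.
Qed.

Lemma forces_exin u p e y t f : p <= elt u (term_val (upd e y u) t) ->
  p ⊩[upd e y u] f -> p ⊩[e] (∃ y ∈ t, f).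
Proof.
move=> pt pf; apply: (forces_ex (u := u)).
by apply/forces_and; split=> //; rewrite val_mem /= /upd eqxx.
Qed.

Lemma forces_exin_elim p e y t f c : p ⊩[e] (∃ y ∈ t, f) ->
  (forall q u, q <= p -> q <= elt u (term_val (upd e y u) t) ->
     q ⊩[upd e y u] f -> q <= c) -> p <= c.
Proof.
move=> pf H; apply: (forces_ex_elim pf) => q u qp.
move=> /forces_and[]; rewrite val_mem /= {1}/upd eqxx; exact: H.
Qed.

Lemma term_val_upd_out e y u (t : term name) :
  y \notin term_fv t -> term_val (upd e y u) t = term_val e t.
Proof. by case: t => //= i; rewrite inE eq_sym /upd => /negPf ->. Qed.

(** By Leibniz' law, it is enough to let a quantifier bounded by a name range
    over the domain of this name. *)
Lemma forces_allin_ndom p e y t f : y \notin term_fv t -> p ⊩[e] (∀ y ∈ t, f) <->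
  forall q w a, q <= p -> value (term_val e t) w a -> q <= a -> q ⊩[upd e y w] f.
Proof.
move=> yt; rewrite forces_allin; split=> H.
  move=> q w a qp tw qa; apply: H => //; rewrite term_val_upd_out //.
  exact: elt_value tw qa.
move=> u q qp; rewrite term_val_upd_out // => ut.
apply: (elt_elim ut) => r w a rq tw ra rwu.
apply: (leibniz rwu); apply: H tw ra; exact: le_trans qp.
Qed.

Lemma forces_exin_elim_ndom p e y t f c : y \notin term_fv t ->
  p ⊩[e] (∃ y ∈ t, f) ->
  (forall q w a, q <= p -> value (term_val e t) w a -> q <= a ->
     q ⊩[upd e y w] f -> q <= c) -> p <= c.
Proof.
move=> yt pf H; apply: (forces_exin_elim pf) => q u qp.
rewrite term_val_upd_out // => ut qf.
apply: (elt_elim ut) => r w a rq tw ra rwu.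
apply: (H r w a) => //; first exact: le_trans qp.
by apply: (leibniz (u := u)); rewrite 1?eqvC // (le_trans rq).
Qed.

(** ** Comprehension *)

(** Turns a leading hypothesis [uniq [:: x; ..]] into the disequalities that the
    next two tactics use to look up variables in updated environments. *)
Ltac distinct := rewrite /= !inE ?negb_or ?andbT -?andbA;
  repeat (let H := fresh "neq" in case/andP => H);
  let H := fresh "neq" in move=> H.

Ltac eval_vars := rewrite ?val_mem ?val_eqv /=;
  repeat first [rewrite upd_same
    | rewrite upd_other; last by [|rewrite eq_sym]].

Ltac decide_vars := rewrite /= ?inE;
  repeat (match goal with
  | |- context [?a == ?a] => rewrite (eqxx a)
  | |- context [?a == ?b] =>
      rewrite (_ : (a == b) = false); last by apply/negbTE; (by [] || rewrite eq_sym)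
  end; rewrite /= ?inE).

(** The inequality [F u <= bigJoin [set eqv w u | w in D]], as the elimination
    rule in which it is used. *)
Definition concentrated (D : set name) (F : name -> A) : Prop :=
  forall p u c, p <= F u ->
    (forall q w, q <= p -> D w -> q <= eqv w u -> q <= c) -> p <= c.

(** The name is the restriction of [F] to [D]: extensionality of [F] gives
    [elt u v <= F u], and concentration the converse. *)
Lemma comprehension (D : set name) (F : name -> A) : small D ->
  (forall p u v, p <= eqv u v -> p <= F u -> p <= F v) -> concentrated D F ->
  exists v, forall p u, p <= elt u v <-> p <= F u.
Proof.
move=> sD extF DF; have [v Hv] := name_of code_inj F sD.
exists v => p u; split=> [puv|pF].
  apply: (elt_elim puv) => q w a qp /Hv[_ ->] qF qwu.
  exact: extF qwu qF.
apply: (DF _ _ _ pF) => q w qp Dw qwu; apply: (elt_intro (w := w) (a := F w)) => //.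
  by apply/Hv.
by apply: (extF _ u); [rewrite eqvC|exact: le_trans pF].
Qed.

Lemma forces_comprehension (D : set name) p e (z w : nat) f :
  z != w -> w \notin fv f ->
  small D -> concentrated D (fun u => val (upd e z u) f) ->
  p ⊩[e] (∃ w, ∀ z, (z ∈ w ⟷ f)).
Proof.
move=> zw wf sD Df; have [|v Hv] := comprehension sD _ Df.
  by move=> q u v; exact: leibniz.
apply: (forces_ex (u := v)); apply/forces_all => u; apply/forces_iff => q _.
by eval_vars; rewrite updC 1?eq_sym // val_upd_out.
Qed.

(** * The axioms *)

Lemma forces_extensionality p e x y z : uniq [:: x; y; z] ->
  p ⊩[e] (∀ x, ∀ y, ((∀ z, (z ∈ x ⟷ z ∈ y)) ⟶ x ≈ y)).
Proof.
distinct; apply/forces_all => u; apply/forces_all => v; apply/forces_imp => q _.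
move=> /forces_all uv; eval_vars; apply/le_eqv.
have H r w : r <= q -> r <= elt w u <-> r <= elt w v.
  by move=> rq; have /forces_iff/(_ r rq) := uv w; eval_vars.
by split=> r w a rq vw ra; apply/H => //; exact: elt_value vw ra.
Qed.

Lemma forces_pairing p e (x y z w : nat) : uniq [:: x; y; z; w] ->
  p ⊩[e] (∀ x, ∀ y, ∃ w, ∀ z, (z ∈ w ⟷ (z ≈ x ⋁ z ≈ y))).
Proof.
distinct; apply/forces_all => u; apply/forces_all => v.
apply: (forces_comprehension (D := [set u; v])) => //; last 1 first.
- move=> q t c qf H; apply: (forces_or_elim qf) => r rq; eval_vars => rt.
    by apply: (H r u) => //; [left|rewrite eqvC].
  by apply: (H r v) => //; [right|rewrite eqvC].
- by decide_vars.
- exact: small2.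
Qed.

Lemma forces_powerset p e (x y z w : nat) : uniq [:: x; y; z; w] ->
  p ⊩[e] (∀ x, ∃ w, ∀ z, (z ∈ w ⟷ (∀ y ∈ z, (y ∈ x)))).
Proof.
distinct; apply/forces_all => X.
apply: (forces_comprehension (D := [set t | ndom t `<=` ndom X])) => //; last 1 first.
- move=> q u c qf H.
  (* [u] is forced to be equal to the name on [ndom X] with values [s ∈ u]. *)
  have [t Ht] := name_of code_inj (fun s => elt s u) (small_ndom X).
  apply: (H q t) => //; first by move=> s [a /Ht[]].
  apply/le_eqv; split=> r s a rq; first by move=> /Ht[_ ->].
  move=> us ra; have su := elt_value us ra.
  have sX : r <= elt s X.
    move: qf => /forces_allin/(_ s r rq); eval_vars; exact.
  apply: (elt_elim sX) => r' s' b r'r Xs' _ s's.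
  have s'u : r' <= elt s' u.
    by apply: (elt_eqv _ (eqv_refl r' u) (le_trans r'r su)); rewrite eqvC.
  by apply: (elt_intro (w := s') (a := elt s' u)) => //; apply/Ht; split=> //; exists b.
- by decide_vars.
- exact: small_ndom_sub.
Qed.

Lemma forces_separation p e (x z w : nat) f : uniq [:: x; z; w] -> w \notin fv f ->
  p ⊩[e] (∀ x, ∃ w, ∀ z, (z ∈ w ⟷ (z ∈ x ⋀ f))).
Proof.
distinct => wf; apply/forces_all => X.
apply: (forces_comprehension (D := ndom X)) => //; last 1 first.
- move=> q u c /forces_and[qX _] H; move: qX; eval_vars => qX.
  by apply: (elt_elim qX) => r w' a rq Xw' _; apply: H => //; exists a.
- by decide_vars.
- exact: small_ndom.
Qed.

Lemma forces_empty_set p e x z : uniq [:: x; z] ->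
  p ⊩[e] (∃ x, ∀ z, (z ∈ x ⟷ (z ≈ z ⟶ ⊥))).
Proof.
distinct; apply: (forces_comprehension (D := set0)); last 1 first.
- move=> q u c /forces_imp/(_ q (lexx q)) H _; apply: (le_trans (H _)).
    by rewrite val_eqv; exact: eqv_refl.
  by rewrite val_bot le0x.
- by decide_vars.
- by decide_vars.
- exact: small0.
Qed.

Lemma forces_union p e (x y z w : nat) : uniq [:: x; y; z; w] ->
  p ⊩[e] (∀ x, ∃ w, ∀ z, (z ∈ w ⟷ (∃ y ∈ x, (z ∈ y)))).
Proof.
distinct; apply/forces_all => X.
apply: (forces_comprehension (D := \bigcup_(v in ndom X) ndom v)) => //; last 1 first.
- move=> q u c qf H; apply: (forces_exin_elim_ndom _ qf) => [|r v a rq].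
    by decide_vars.
  eval_vars => Xv _ uv; apply: (elt_elim uv) => r' t b r'r vt _.
  by apply: (H r' t) => //; [exact: le_trans rq|exists v; [exists a|exists b]].
- by decide_vars.
- exact: (small_bigcup (@sval_name_inj _ _ _) (small_ndom X) (fun v _ => small_ndom v)).
Qed.

(** One witness is chosen for each [u] in [D] and each value in [A]; there is
    only a set of such pairs because [A] is a set. *)
Lemma small_witnesses (D : set name) (F : name -> name -> A) : small D ->
  exists2 W, small W & forall u v, D u -> exists2 w, W w & F u v = F u w.
Proof.
move=> sD.
have /choice [g Hg] : forall ua : name * A, exists w,
    forall v, F ua.1 v = ua.2 -> F ua.1 w = ua.2.
  move=> [u a]; have [[w Hw]|H] := pselect (exists w, F u w = a).
    by exists w.
  by exists u => v Hv; case: H; exists v.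
exists (\bigcup_(u in D) range (fun a => g (u, a))).
  apply: (small_bigcup (@sval_name_inj _ _ _) sD) => u _.
  exact: small_image code_inj code_set.
move=> u v Du; exists (g (u, F u v)); first by exists u => //; exists (F u v).
by rewrite (Hg (u, F u v) v).
Qed.

(** The bounding name [v] has value [\top] on a small class of witnesses for the
    members of the domain of [X]; Leibniz' law, within [forces_allin_ndom],
    extends the conclusion to all members of [X]. *)
Lemma forces_collection p e (x y z w : nat) f :
  uniq [:: x; y; z; w] -> w \notin fv f ->
  p ⊩[e] (∀ x, ((∀ y ∈ x, ∃ z, f) ⟶ (∃ w, ∀ y ∈ x, ∃ z ∈ w, f))).
Proof.
distinct => wf; apply/forces_all => X; apply/forces_imp => q _.
set e' := upd e x X => qf.
have [W sW HW] :=
  small_witnesses (fun u v => val (upd (upd e' y u) z v) f) (small_ndom X).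
have [v Hv] := name_of code_inj (fun=> \top) sW.
apply: (forces_ex (u := v)); apply/forces_allin_ndom => [|r u a rq].
  by decide_vars.
eval_vars; rewrite /e'; eval_vars; rewrite -/e' => Xu ra.
have : r ⊩[upd e' y u] (∃ z, f).
  move: qf => /forces_allin_ndom H; apply: (H _ r u a) => //; first by decide_vars.
  by rewrite /e'; eval_vars.
move/forces_ex_elim; apply=> r' t r'r.
have [|t' Wt' ->] := HW u t; first by exists a.
move=> Ht'; apply: (forces_exin (u := t')).
  by eval_vars; apply: (elt_value (a := \top)) (lex1 _); apply/Hv.
(* The update of [w] is moved outermost, where it disappears since [w] is not
   free in [f]. *)
by rewrite (updC e' v u) 1?eq_sym // (updC _ v t') 1?eq_sym // val_upd_out.
Qed.

(** By induction on the name [u] substituted for [x]: bounded by [u], the inner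
    quantifier ranges over the domain of [u]. *)
Lemma forces_regularity p e (x y : nat) f :
  uniq [:: x; y] -> y \notin fv f -> free_for y x f ->
  p ⊩[e] ((∀ x, ((∀ y ∈ x, subst x y f) ⟶ f)) ⟶ (∀ x, f)).
Proof.
distinct => yf yx; apply/forces_imp => q _ /forces_all H; apply/forces_all => u.
elim/name_ind: u => u IH.
move/forces_imp: (H u) => /(_ q (lexx q)); apply.
apply/forces_allin_ndom => [|r w a rq]; first by decide_vars.
(* Substituting [y] for [x] makes [w] the value of [x]; the update of [y] then
   disappears since [y] is not free in [f]. *)
eval_vars => uw _; rewrite val_subst_var // upd_same (updC _ w w) 1?eq_sym // upd_upd.
rewrite val_upd_out //; exact: le_trans rq (IH w a uw).
Qed.

(** The members of the canonical name of [t] are, up to [eqv], the canonical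
    names of the members of [t]: [elt u (check t)] is the join of the
    [eqv (check s) u], given here by its introduction and elimination rules. *)
Lemma elt_check (check : V -> name) :
  (forall (t : V) w a,
     value (check t) w a <-> (exists2 s : V, mem s t & w = check s) /\ a = \top) ->
  forall p u (t : V),
  (forall s : V, mem s t -> p <= eqv (check s) u -> p <= elt u (check t)) /\
  (forall c, p <= elt u (check t) ->
     (forall q (s : V), q <= p -> mem s t -> q <= eqv (check s) u -> q <= c) -> p <= c).
Proof.
move=> Hc p u t; split=> [s st|c H H'].
  by apply: elt_intro (lex1 p); apply/Hc; split=> //; exists s.
apply: (elt_elim H) => q w a qp /Hc[[s st ->] _] _; exact: H'.
Qed.

Lemma forces_infinity p e (x y z i s : nat) : uniq [:: x; y; z; i; s] ->
  p ⊩[e] (∃ x, ((∃ i ∈ x, ∀ z, (z ∈ i ⟷ (z ≈ z ⟶ ⊥)))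
           ⋀ (∀ y ∈ x, ∃ s ∈ x, ∀ z, (z ∈ s ⟷ (z ∈ y ⋁ z ≈ y))))).
Proof.
distinct.
have [check Hc] := check_names code_inj (\top : A).
have Ec := elt_check Hc.
have [t0 [[e0 e0t e0E] t0S]] := zf_infinity V.
apply: (forces_ex (u := check t0)); apply/forces_and; split.
  apply: (forces_exin (u := check e0)).
    by eval_vars; apply: (proj1 (Ec _ _ _)) e0t (eqv_refl _ _).
  apply/forces_all => u; apply/forces_iff => q qp; eval_vars; split=> H.
    by apply: (proj2 (Ec _ _ _) _ H) => r s' _ /e0E.
  apply: (le_trans (y := \bot)) (le0x _); rewrite -(val_bot e).
  move/forces_imp: H => /(_ q (lexx q)); rewrite !val_bot; apply.
  by eval_vars; exact: eqv_refl.
apply/forces_allin => u q qp; eval_vars => ut.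
apply: (proj2 (Ec _ _ _) _ ut) => r n rq nt nu.
(* [u] is forced to be equal to the canonical name of [n], so the canonical name
   of the successor [n'] of [n] is a successor of [u]. *)
have [n' n't n'E] := t0S n nt.
apply: (forces_exin (u := check n')).
  by eval_vars; apply: (proj1 (Ec _ _ _)) n't (eqv_refl _ _).
apply/forces_all => v; apply/forces_iff => r' r'r; eval_vars.
have r'nu := le_trans r'r nu.
split=> H.
  apply: (proj2 (Ec _ _ _) _ H) => r1 m r1r' /n'E[mn|->] mv.
    apply: forces_orl; eval_vars.
    apply: (elt_eqv mv (le_trans r1r' r'nu)).
    exact: (proj1 (Ec _ _ _)) mn (eqv_refl _ _).
  apply: forces_orr; eval_vars; rewrite eqvC in mv.
  exact: eqv_trans mv (le_trans r1r' r'nu).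
apply: (forces_or_elim H) => r1 r1r'; eval_vars => H1.
  have : r1 <= elt v (check n).
    apply: elt_eqv (eqv_refl _ v) _ H1; rewrite eqvC; exact: le_trans r'nu.
  move=> H2; apply: (proj2 (Ec _ _ _) _ H2) => r2 m r2r1 mn mv.
  by apply: (proj1 (Ec _ _ _)) mv; apply/n'E; left.
apply: (proj1 (Ec _ _ n') n); first by apply/n'E; right.
by apply: eqv_trans (le_trans r1r' r'nu) _; rewrite eqvC.
Qed.

Lemma forces_axiom p e f : ZF_N4_axiom f -> p ⊩[e] f.
Proof.
case.
- exact: forces_extensionality.
- exact: forces_pairing.
- exact: forces_collection.
- exact: forces_powerset.
- exact: forces_separation.
- exact: forces_empty_set.
- exact: forces_union.
- exact: forces_infinity.
- exact: forces_regularity.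
Qed.

(** Being a sentence, the universal closure of [f] is its own instance in any
    environment, and an environment exists because there is a name, the empty
    one. *)
Lemma valid_universal_closure f :
  (forall p e, p ⊩[e] f) -> valid I (universal_closure f).
Proof.
move=> Hf; have [u _] := name_of code_inj (fun=> \top) (small0 _).
have E : inst (fun=> Some u) (universal_closure f) = universal_closure f.
  rewrite -[RHS]inst_None; apply: eq_inst => i.
  have foldE t : (i \in fv (foldr (@All name) f t)) = (i \in fv f) && (i \notin t).
    elim: t => /= [|x t IH]; first by rewrite andbT.
    by rewrite mem_filter IH inE negb_or andbCA.
  by rewrite foldE mem_undup andbN.
apply/le_anti; rewrite lex1 /= -E -/(val (fun=> u) _).
rewrite /universal_closure; elim: (undup _) (fun=> u) => //= x s IH e.
by apply/forces_all => v; exact: IH.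
Qed.

End Forcing.

(* [A] is a set of the model: [code] identifies it with a set of elements
   of [V]. *)
Theorem corollary4p13 (V : zfModel) (d : Order.disp_t)
    (A : completeHeytingType d) (code : A -> V)
    (code_inj : injective code) (code_set : is_set (range code))
    (N : A -> set A) (N_saturated : saturated N)
    (I : formula (name code) -> A) (I_interp : interpretation N I)
    (f : formula (name code)) :
  ZF_N4_axiom f -> valid I (universal_closure f).
Proof.
move=> f_axiom; apply: (valid_universal_closure code_inj I_interp) => p e.
exact: (forces_axiom code_inj code_set I_interp).
Qed.
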